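(* Let $k$ be a field and $R=k[x_1,\dots,x_n]$. Let $J_1,J_2,J_3\subseteq[n]=\{1,\dots,n\}$ be three nonempty sets, and let $a_1,a_2,a_3$ be three positive integers. Then $\mathfrak m_{J_1}^{a_1}\cap\mathfrak m_{J_2}^{a_2}\cap\mathfrak m_{J_3}^{a_3}\subset R$ is componentwise linear.
   Context: For a nonempty subset $J=\{j_1,\dots,j_t\}\subseteq[n]$, $\mathfrak m_J=(x_{j_1},\dots,x_{j_t})\subset R$. $R$ is standard graded. For a homogeneous ideal $I$, $(I_d)$ is the ideal of $R$ generated by all elements of $I$ of degree $d$. A homogeneous ideal generated in degree $d$ has a linear resolution if its graded Betti numbers satisfy $\beta_{i,j}=0$ for all $i\ge 0$ and $j\neq i+d$. A homogeneous ideal $I$ is componentwise linear if $(I_d)$ has a linear resolution for every $d$ (the zero ideal counts as having a linear resolution). *)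

(* Defs.v *)
From mathcomp Require Import all_boot all_algebra.
From mathcomp Require Import mpoly.

Set Implicit Arguments.
Unset Strict Implicit.
Unset Printing Implicit Defensive.

Import GRing.Theory.
Local Open Scope ring_scope.

(* Subsets of a ring, in particular ideals, are Prop-valued predicates, since
   membership in an arbitrary ideal is not given by a boolean test. *)
Section Ideals.

Variable R : comNzRingType.
Implicit Types (S I K : R -> Prop) (p : R).

Definition ideal_gen S p : Prop :=
  exists (m : nat) (c g : 'I_m -> R),
    (forall i, S (g i)) /\ p = \sum_(i < m) c i * g i.

Definition ideal_mul I K : R -> Prop :=
  ideal_gen (fun p => exists f g, [/\ I f, K g & p = f * g]).

Fixpoint ideal_pow I (a : nat) : R -> Prop :=
  if a is b.+1 then ideal_mul I (ideal_pow I b) else fun=> True.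

End Ideals.

(* In all that follows {mpoly k[n]} is standard graded: p \is d.-homog means
   that every monomial of p has total degree d (so 0 \is d.-homog). *)
Section Graded.

Variables (k : fieldType) (n : nat).
Local Notation R := {mpoly k[n]}.
Implicit Types (I : R -> Prop) (p : R).

Definition var_ideal (J : {set 'I_n}) : R -> Prop :=
  ideal_gen (fun p => exists2 j, j \in J & p = 'X_j).

(* I is an ideal generated by homogeneous elements. *)
Definition homogeneous_ideal I : Prop :=
  forall p, I p <-> ideal_gen (fun q => I q /\ exists d, q \is d.-homog) p.

Definition component I (d : nat) : R -> Prop :=
  ideal_gen (fun p => I p /\ p \is d.-homog).

Definition generated_in_degree (d : nat) I : Prop :=
  forall p, I p <-> component I d p.

(* The matrix A acts on row vectors by v |-> v *m A; the condition says that it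
   is a degree 0 map
     R(-s 0) (+) ... (+) R(-s (r-1))  -->  R(-t 0) (+) ... (+) R(-t (q-1)). *)
Definition graded_map (r q : nat) (s : 'I_r -> nat) (t : 'I_q -> nat)
    (A : 'M[R]_(r, q)) : Prop :=
  forall i j,
    if (t j <= s i)%N then A i j \is (s i - t j).-homog else A i j == 0.

(* A sequence of finite graded free modules
     ... --> F_2 --diff 1--> F_1 --diff 0--> F_0 --aug--> R,
   with F_i the direct sum of the R(- shift i a) for a < rank i.  Finite
   resolutions are those with rank i = 0 for large i.  Natural numbers suffice
   as shifts for the minimal resolution of an ideal of R. *)
Record free_chain := FreeChain {
  rank : nat -> nat;
  shift : forall i, 'I_(rank i) -> nat;
  aug : 'cV[R]_(rank 0);
  diff : forall i, 'M[R]_(rank i.+1, rank i)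
}.

Record minimal_graded_free_resolution (F : free_chain) I : Prop := {
  aug_graded : graded_map (@shift F 0) (fun _ : 'I_1 => 0%N) (aug F);
  diff_graded : forall i, graded_map (@shift F i.+1) (@shift F i) (diff F i);
  aug_image : forall p, I p <-> exists v : 'rV_(rank F 0), v *m aug F = p%:M;
  exact_aug : forall v : 'rV_(rank F 0),
    v *m aug F = 0 <-> exists w, v = w *m diff F 0;
  exact_diff : forall i (v : 'rV_(rank F i.+1)),
    v *m diff F i = 0 <-> exists w, v = w *m diff F i.+1;
  (* the image of F_(i+1) lies in (x_1, ..., x_n) F_i *)
  diff_minimal : forall i a b, var_ideal [set: 'I_n] (diff F i a b)
}.

(* beta_(i,j): the number of copies of R(-j) in F_i. *)
Definition betti (F : free_chain) (i j : nat) : nat :=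
  #|[set a : 'I_(rank F i) | shift a == j]|.

(* The graded Betti numbers of I are those of its minimal graded free
   resolution, which exists and is unique up to isomorphism, so that it does
   not matter which one is taken.  For I = 0 all modules F_i are 0, so the
   zero ideal has a linear resolution for every d. *)
Definition linear_resolution (d : nat) I : Prop :=
  [/\ homogeneous_ideal I, generated_in_degree d I &
      exists2 F, minimal_graded_free_resolution F I &
        forall i j, j <> (i + d)%N -> betti F i j = 0%N].

Definition componentwise_linear I : Prop :=
  homogeneous_ideal I /\ forall d, linear_resolution d (component I d).

End Graded.

Arguments var_ideal k {n} J _.

(* Main.v *)
(* A monomial lies in the intersection iff its degree in the variables of each
   J_i is at least a_i.  Order the variables by the number of the J_i containing
   them, and the monomials of degree d of the ideal lexicographically, with the
   most frequent variables first.  Each colon ideal (earlier monomials) : v is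
   then generated by variables.

   Linear quotients by variables pass to syzygies.  If A_a are the rows of a
   matrix and (A_b, b < a) : A_a = (x_j, j in S_a), then each x in S_a gives a
   syzygy with leading term x e_a.  These syzygies generate the kernel, and
   ordered lexicographically by (a, x) they have linear quotients with variable
   sets {y in S_a, y < x}.  All entries of the successive syzygy matrices are
   linear forms, so iterating gives a minimal linear resolution. *)

Require Import Defs.
From mathcomp Require Import all_boot all_algebra.
From mathcomp Require Import mpoly.
From mathcomp Require Import zify.
From Stdlib Require Import IndefiniteDescription.

Set Implicit Arguments.
Unset Strict Implicit.
Unset Printing Implicit Defensive.

Import GRing.Theory.

(** * Ideals generated by a set *)

Section IdealGen.

Local Open Scope ring_scope.
Variable R : comNzRingType.
Implicit Types (S T K : R -> Prop) (p : R).

Lemma ideal_gen_ind S K p :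
    K 0 -> (forall p q, K p -> K q -> K (p + q)) ->
    (forall c g, S g -> K (c * g)) ->
  ideal_gen S p -> K p.
Proof.
move=> K0 KD KS [m [c [g [Sg ->]]]].
by apply: big_ind => // i _; apply: KS.
Qed.

(** With lists of pairs, adding two combinations is concatenation, and no arithmetic on the index
    type ['I_m] is needed. *)
Lemma ideal_genP S p :
  ideal_gen S p <-> exists2 s : seq (R * R),
    (forall q, q \in s -> S q.2) & p = \sum_(q <- s) q.1 * q.2.
Proof.
split=> [[m [c [g [Sg ->]]]] | [s Ss ->]].
  exists [seq (c i, g i) | i <- enum 'I_m]; last by rewrite big_map big_enum.
  by move=> q /mapP [i _ ->]; apply: Sg.
exists (size s), (fun i => (tnth (in_tuple s) i).1),
  (fun i => (tnth (in_tuple s) i).2).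
by split=> [i | ]; [apply/Ss/mem_tnth | rewrite big_tnth].
Qed.

Lemma ideal_gen0 S : ideal_gen S 0.
Proof. by apply/ideal_genP; exists [::] => //; rewrite big_nil. Qed.

Lemma ideal_genD S p q : ideal_gen S p -> ideal_gen S q -> ideal_gen S (p + q).
Proof.
move=> /ideal_genP [s Ss ->] /ideal_genP [t St ->].
apply/ideal_genP; exists (s ++ t); last by rewrite big_cat.
by move=> r; rewrite mem_cat => /orP [/Ss | /St].
Qed.

Lemma ideal_genM S c p : ideal_gen S p -> ideal_gen S (c * p).
Proof.
move=> /ideal_genP [s Ss ->]; apply/ideal_genP.
exists [seq (c * q.1, q.2) | q <- s].
  by move=> r /mapP [q /Ss Sq ->].
by rewrite big_map mulr_sumr; apply: eq_bigr => q _; rewrite /= mulrA.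
Qed.

Lemma ideal_gen_id S p : S p -> ideal_gen S p.
Proof.
move=> Sp; apply/ideal_genP; exists [:: (1, p)]; last by rewrite big_seq1 mul1r.
by move=> q; rewrite inE => /eqP ->.
Qed.

Lemma ideal_gen_sum S (T : Type) (s : seq T) (P : pred T) (F : T -> R) :
  (forall i, P i -> ideal_gen S (F i)) -> ideal_gen S (\sum_(i <- s | P i) F i).
Proof.
by move=> SF; apply: big_ind => //; [apply: ideal_gen0 | apply: ideal_genD].
Qed.

Lemma ideal_gen_sub S T p :
  (forall q, T q -> ideal_gen S q) -> ideal_gen T p -> ideal_gen S p.
Proof.
move=> TS; apply: ideal_gen_ind => [||c g /TS]; first exact: ideal_gen0.
  exact: ideal_genD.
exact: ideal_genM.
Qed.

End IdealGen.

(** * Monomial ideals through the exponents of their elements *)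

Section MonomialIdeals.

Local Open Scope ring_scope.
Variables (k : fieldType) (n : nat).
Local Notation R := {mpoly k[n]}.
Implicit Types (p q : R) (u v m : 'X_{1..n}) (J : {set 'I_n}).

Definition upward_closed (Q : pred 'X_{1..n}) :=
  forall m m', Q m -> Q (m + m')%MM.

Definition monomials_in (Q : pred 'X_{1..n}) p := {in msupp p, forall m, Q m}.

Lemma monomials_inD Q p q :
  monomials_in Q p -> monomials_in Q q -> monomials_in Q (p + q).
Proof. by move=> Qp Qq m /msuppD_le; rewrite mem_cat => /orP [/Qp | /Qq]. Qed.

Lemma monomials_in0 Q : monomials_in Q 0.
Proof. by move=> m; rewrite msupp0. Qed.

Lemma monomials_inM Q c p :
  upward_closed Q -> monomials_in Q p -> monomials_in Q (c * p).
Proof.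
move=> upQ Qp m /msuppM_le /allpairsP [[m1 m2] [_ /Qp Qm2 ->]].
by rewrite addmC; apply: upQ.
Qed.

Lemma monomials_in_ideal_gen Q (S : R -> Prop) p :
    upward_closed Q -> (forall q, S q -> monomials_in Q q) ->
  ideal_gen S p -> monomials_in Q p.
Proof.
move=> upQ SQ; apply: ideal_gen_ind => [||c g /SQ].
- exact: monomials_in0.
- exact: monomials_inD.
- exact: monomials_inM.
Qed.

Lemma ideal_gen_monomials_in (Q : pred 'X_{1..n}) (S : R -> Prop) p :
    (forall m, Q m -> ideal_gen S 'X_[m]) ->
  monomials_in Q p -> ideal_gen S p.
Proof.
move=> QS Qp; rewrite [p]mpolyE big_seq; apply: ideal_gen_sum => m /Qp /QS.
by rewrite -mul_mpolyC; apply: ideal_genM.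
Qed.

Definition degree_in J m := (\sum_(j in J) m j)%N.

Lemma degree_inD J u v : degree_in J (u + v)%MM = (degree_in J u + degree_in J v)%N.
Proof. by rewrite /degree_in -big_split; apply: eq_bigr => j _; rewrite mnmDE. Qed.

Lemma degree_inU J x : degree_in J U_(x)%MM = (x \in J).
Proof.
rewrite /degree_in; have [xJ | xJ] := boolP (x \in J).
  rewrite (bigD1 x) //= mnm1E eqxx big1 // => j /andP [_ jx].
  by rewrite mnm1E eq_sym (negbTE jx).
rewrite big1 // => j jJ; rewrite mnm1E.
by case: eqP xJ => // ->; rewrite jJ.
Qed.

Lemma degree_in_upward_closed J a : upward_closed [pred m | a <= degree_in J m]%N.
Proof. by move=> m m' /=; rewrite degree_inD; lia. Qed.

Lemma degree_in_gt0 J m : (0 < degree_in J m)%N -> exists2 j, j \in J & (0 < m j)%N.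
Proof.
rewrite lt0n /degree_in sum_nat_eq0 negb_forall => /existsP [j].
by rewrite negb_imply -lt0n => /andP [jJ mj]; exists j.
Qed.

Lemma monomial_split m j : (0 < m j)%N -> (m = U_(j) + (m - U_(j)))%MM.
Proof. by move=> mj; rewrite addmC submK // lep1mP -lt0n. Qed.

(** By induction on a: a monomial of J-degree greater than a contains a variable of J, and splitting
    it off leaves J-degree at least a. From here on the intersection of powers is handled purely by
    exponents. *)
Lemma ideal_powP J a p :
  ideal_pow (var_ideal k J) a p <->
  monomials_in [pred m | a <= degree_in J m]%N p.
Proof.
elim: a p => [|a IHa] p; first by split.
have inX j m : j \in J -> (monomials_in [pred m | 1 <= degree_in J m]%N ('X_j : R)).
  by move=> jJ m' /mem_msuppXP <- /=; rewrite degree_inU jJ.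
split.
  apply: monomials_in_ideal_gen; first exact: degree_in_upward_closed.
  move=> q [f [g [If /IHa Ig ->]]] m.
  move=> /msuppM_le /allpairsP [[m1 m2] [/= m1f /Ig /= Qm2 ->]].
  suff: (0 < degree_in J m1)%N by rewrite degree_inD; lia.
  move: m1 m1f; apply: monomials_in_ideal_gen If.
    exact: (@degree_in_upward_closed J 1).
  by move=> h [j jJ ->]; apply: inX.
apply: (@ideal_gen_monomials_in [pred m | a < degree_in J m]%N) => m /= am.
have [|j jJ mj] := @degree_in_gt0 J m; first by lia.
apply: ideal_gen_id; exists 'X_j, 'X_[m - U_(j)]; split.
- by apply: ideal_gen_id; exists j.
- apply/IHa => m' /mem_msuppXP <- /=.
  by move: am; rewrite {1}(monomial_split mj) degree_inD degree_inU jJ.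
- by rewrite -mpolyXD -monomial_split.
Qed.

Lemma var_idealP J p :
  var_ideal k J p <-> {in msupp p, forall m, exists2 j, j \in J & 0 < m j}%N.
Proof.
split.
  move=> Jp m mp; apply: degree_in_gt0; move: m mp.
  apply: monomials_in_ideal_gen Jp; first exact: (@degree_in_upward_closed J 1).
  by move=> q [j jJ ->] m' /mem_msuppXP <- /=; rewrite degree_inU jJ.
move=> Jp; rewrite [p]mpolyE big_seq; apply: ideal_gen_sum => m /Jp [j jJ mj].
rewrite -mul_mpolyC (monomial_split mj) addmC mpolyXD mulrA.
by apply/ideal_genM/ideal_gen_id; exists j.
Qed.

Lemma var_ideal_coefs J p :
  var_ideal k J p -> exists c : 'I_n -> R, p = \sum_(j in J) c j * 'X_j.
Proof.
pose K p := exists c : 'I_n -> R, p = \sum_(j in J) c j * 'X_j.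
apply: (@ideal_gen_ind _ _ K) => [|q r [c ->] [c' ->]|c g [j jJ ->]].
- by exists (fun=> 0); rewrite big1 // => j _; rewrite mul0r.
- exists (fun j => c j + c' j); rewrite -big_split.
  by apply: eq_bigr => j _; rewrite mulrDl.
- exists (fun i => if i == j then c else 0).
  by rewrite (bigD1 j) //= eqxx big1 ?addr0 // => i /andP [_ /negbTE ->]; rewrite mul0r.
Qed.

(** Multiplication by x shifts the support of f by [U_(x)], which adds no exponent in J; so x is a
    nonzerodivisor modulo the variables of J. *)
Lemma var_ideal_prime_to_var J x f :
  x \notin J -> var_ideal k J (f * 'X_x) -> var_ideal k J f.
Proof.
move=> xJ /var_idealP Jfx; apply/var_idealP => m mf.
have [|j jJ] := Jfx (U_(x) + m)%MM.
  by rewrite mcoeff_msupp mcoeffMX -mcoeff_msupp.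
rewrite mnmDE mnm1E; case: eqP => [xj | _]; first by rewrite -xj (negbTE xJ) in jJ.
by exists j.
Qed.

Lemma var_ideal_X J j : j \in J -> var_ideal k J 'X_j.
Proof. by move=> jJ; apply: ideal_gen_id; exists j. Qed.

(** Serves to cut a syzygy of a homogeneous matrix down to one of its graded components. *)
Lemma pihomogM d e p q :
  q \is e.-homog -> pihomog mdeg (d + e)%N (p * q) = pihomog mdeg d p * q.
Proof.
move=> qe; rewrite [p]mpolyE mulr_suml !linear_sum /= mulr_suml.
apply: eq_bigr => m _; rewrite -scalerAl !linearZ /= -scalerAl; congr (_ *: _).
rewrite pihomogX; have Xq : ('X_[m] * q) \is (mdeg m + e)%N.-homog.
  by apply: dhomogM => //; rewrite dhomogX.
case: eqP => [<- | /eqP dm]; first by rewrite pihomog_dE.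
by rewrite mul0r (pihomog_ne0 _ Xq) // eqn_add2r.
Qed.

End MonomialIdeals.

(** As x and y are smaller than n, they act as the last digit in base n. This packs a lexicographic
    order on pairs into one number, both for syzygies and for variables. *)
Lemma lex_key (n c d : nat) (x y : 'I_n) :
  (c * n + x < d * n + y)%N = (c < d)%N || (c == d) && (x < y)%N.
Proof.
have := ltn_ord x; have := ltn_ord y.
case: (ltngtP c d) => [cd | dc | ->] /= yn xn; last by rewrite ltn_add2l.
  by have := leq_mul2r n c.+1 d; rewrite cd orbT mulSn => /idP; lia.
by have := leq_mul2r n d.+1 c; rewrite dc orbT mulSn => /idP; lia.
Qed.

Lemma lex_key_inj (n c d : nat) (x y : 'I_n) :
  (c * n + x = d * n + y)%N -> c = d /\ x = y.
Proof.
move=> eq_key; have := lex_key c d x y; have := lex_key d c y x.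
rewrite eq_key ltnn; case: (ltngtP c d) => //= ->.
by case: (ltngtP x y) => // /val_inj.
Qed.

(** * Matrices with linear quotients *)

Section LinearQuotients.

Local Open Scope ring_scope.
Variables (k : fieldType) (n : nat).
Local Notation R := {mpoly k[n]}.

(** The restriction to D is put on the coefficients, so that no submatrix of A has to be formed when
    D varies. *)
Definition spanned (r q : nat) (A : 'M[R]_(r, q)) (D : pred 'I_r) (w : 'rV_q) :=
  exists2 c : 'rV_r, (forall b, ~~ D b -> c 0 b = 0) & w = c *m A.

Section Spanned.

Variables (r q : nat) (A : 'M[R]_(r, q)).
Implicit Types (D : pred 'I_r) (w : 'rV[R]_q).

Lemma spanned0 D : spanned A D 0.
Proof. by exists 0 => [b _|]; rewrite ?mxE ?mul0mx. Qed.

Lemma spannedD D w1 w2 : spanned A D w1 -> spanned A D w2 -> spanned A D (w1 + w2).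
Proof.
move=> [c1 c1D ->] [c2 c2D ->]; exists (c1 + c2); last by rewrite mulmxDl.
by move=> b Db; rewrite mxE c1D // c2D // addr0.
Qed.

Lemma spannedZ D f w : spanned A D w -> spanned A D (f *: w).
Proof.
move=> [c cD ->]; exists (f *: c); last by rewrite scalemxAl.
by move=> b Db; rewrite mxE cD // mulr0.
Qed.

Lemma spanned_sum D (I : Type) (s : seq I) (P : pred I) (F : I -> 'rV[R]_q) :
  (forall i, P i -> spanned A D (F i)) -> spanned A D (\sum_(i <- s | P i) F i).
Proof.
by move=> FD; apply: big_ind => //; [apply: spanned0 | apply: spannedD].
Qed.

Lemma spanned_row D b : D b -> spanned A D (row b A).
Proof.
move=> Db; exists (delta_mx 0 b); last by rewrite -rowE.
by move=> b' Db'; rewrite mxE; case: (b' =P b) Db' => // ->; rewrite Db.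
Qed.

Lemma spanned_sub D D' w : subpred D D' -> spanned A D w -> spanned A D' w.
Proof.
move=> DD' [c cD ->]; exists c => // b D'b; apply: cD.
by apply: contra D'b; apply: DD'.
Qed.

End Spanned.

(* Ordered by [key], the rows [A_a] satisfy
   [(A_b | key b < key a) : A_a = (x_j | j in S a)]. *)
Definition linear_quotients (r q : nat) (A : 'M[R]_(r, q))
    (key : 'I_r -> nat) (S : 'I_r -> {set 'I_n}) :=
  injective key /\ forall a f,
    spanned A [pred b | key b < key a]%N (f *: row a A) <-> var_ideal k (S a) f.

Definition homogeneous_mx (d r q : nat) (A : 'M[R]_(r, q)) :=
  forall a b, A a b \is d.-homog.

(** * Syzygies of a matrix with linear quotients *)

Section Syzygies.

Variables (e r q : nat) (A : 'M[R]_(r, q)).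
Variables (key : 'I_r -> nat) (S : 'I_r -> {set 'I_n}).
Hypotheses (lqA : linear_quotients A key S) (homA : homogeneous_mx e A).

Definition leading_syzygy a x (v : 'rV[R]_r) :=
  [/\ v *m A = 0, v 0 a = 'X_x,
      forall b, (key a <= key b)%N -> b != a -> v 0 b = 0
    & forall b, v 0 b \is 1.-homog].

Lemma leading_syzygy_exists a x : x \in S a -> exists v, leading_syzygy a x v.
Proof.
move=> xS; have /lqA.2 [c c0 cA] := var_ideal_X k xS.
pose v := 'X_x *: delta_mx 0 a - c.
have vA : v *m A = 0 by rewrite mulmxBl -scalemxAl -rowE -cA subrr.
have v_a : v 0 a = 'X_x.
  by rewrite !mxE !eqxx mulr1 c0 ?subr0 //= ltnn.
have v_b b : (key a <= key b)%N -> b != a -> v 0 b = 0.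
  move=> ab /negbTE ba; rewrite !mxE ba andbF mulr0 c0 ?subr0 //=.
  by rewrite -leqNgt.
(* Only the linear part of v is kept; it is still a syzygy as A is homogeneous. *)
exists (map_mx (pihomog mdeg 1) v); split.
- apply/rowP => j; rewrite !mxE.
  have /rowP /(_ j) := vA; rewrite !mxE => /(congr1 (pihomog mdeg (1 + e))).
  rewrite linear0 linear_sum /= => {2}<-; apply: eq_bigr => b _.
  by rewrite mxE (pihomogM _ _ (homA b j)).
- by rewrite mxE v_a pihomog_dE // dhomogX /= mdeg1.
- by move=> b ab ba; rewrite mxE v_b // linear0.
- by move=> b; rewrite mxE pihomogP.
Qed.

Definition syzygy_index := [set p : 'I_r * 'I_n | p.2 \in S p.1].

Definition syzygy_mx (s : 'I_r * 'I_n -> 'rV[R]_r) : 'M[R]_(#|syzygy_index|, r) :=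
  \matrix_i s (enum_val i).

Variable s : 'I_r * 'I_n -> 'rV[R]_r.
Hypothesis sP : forall a x, x \in S a -> leading_syzygy a x (s (a, x)).
Local Notation B := (syzygy_mx s).

Lemma syzygy_indexP (i : 'I_#|syzygy_index|) :
  exists a x, [/\ enum_val i = (a, x), x \in S a & row i B = s (a, x)].
Proof.
have := enum_valP i; case E: (enum_val i) => [a x]; rewrite inE /= => xS.
by exists a, x; rewrite rowK E.
Qed.

Lemma syzygy_spanned (D : pred 'I_#|syzygy_index|) a x : x \in S a ->
    (forall i : 'I_#|syzygy_index|, enum_val i = (a, x) -> D i) ->
  spanned B D (s (a, x)).
Proof.
move=> xS Di; have axT : (a, x) \in syzygy_index by rewrite inE.
have -> : s (a, x) = row (enum_rank_in axT (a, x)) B.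
  by rewrite rowK enum_rankK_in.
by apply/spanned_row/Di; rewrite enum_rankK_in.
Qed.

(** Division by leading terms: the entry of v at the row of key N is cancelled by syzygies leading
    at that row, and induction on N treats the rest. The conclusion keeps the bound N because the
    linear quotients of the syzygy matrix depend on which syzygies occur. *)
Lemma kernel_spanned N (v : 'rV[R]_r) :
    v *m A = 0 -> (forall b, (N <= key b)%N -> v 0 b = 0) ->
  spanned B [pred i | key (enum_val i).1 < N]%N v.
Proof.
elim: N v => [|N IHN] v vA vN.
  suff -> : v = 0 by apply: spanned0.
  by apply/rowP => b; rewrite vN ?mxE.
have [a /eqP aN | noN] := pickP [pred b | key b == N]; last first.
  have /IHN : forall b, (N <= key b)%N -> v 0 b = 0.
    by move=> b; rewrite leq_eqVlt eq_sym (noN b : (_ == _) = _); apply: vN.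
  by move/(_ vA); apply: spanned_sub => i /=; apply: leqW.
have : var_ideal k (S a) (v 0 a).
  (* Since [v *m A = 0], the entry at a times row a is minus the combination given by the other
     entries of v, all at rows of smaller key. *)
  apply/lqA.2; exists (v 0 a *: delta_mx 0 a - v).
    move=> b /=; rewrite -leqNgt leq_eqVlt => /orP [/eqP /lqA.1 <- | ab].
      by rewrite !mxE !eqxx mulr1 subrr.
    have ba : b != a by apply: contraTneq ab => ->; rewrite ltnn.
    by rewrite !mxE (negbTE ba) andbF mulr0 (vN b) ?subr0 // -aN.
  by rewrite mulmxBl vA subr0 -scalemxAl -rowE.
move=> /var_ideal_coefs [c v_a].
pose w := \sum_(x in S a) c x *: s (a, x).
have wA : w *m A = 0.
  rewrite mulmx_suml big1 // => x xS; have [sA _ _ _] := sP xS.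
  by rewrite -scalemxAl sA scaler0.
rewrite -(subrK w v); apply: spannedD; last first.
  apply: spanned_sum => x xS; apply/spannedZ/syzygy_spanned => // i /= ->.
  by rewrite aN.
apply: (@spanned_sub _ _ _ [pred i | key (enum_val i).1 < N]%N).
  by move=> i /=; apply: leqW.
apply: IHN; first by rewrite mulmxBl vA wA subrr.
move=> b Nb; rewrite !mxE summxE; have [-> | ba] := eqVneq b a.
  rewrite v_a -sumrB big1 // => x xS; have [_ sa _ _] := sP xS.
  by rewrite mxE sa subrr.
rewrite vN ?sub0r; last first.
  by rewrite ltn_neqAle Nb andbT -aN; apply: contra ba => /eqP /lqA.1 ->.
rewrite big1 ?oppr0 // => x xS; have [_ _ s0 _] := sP xS.
by rewrite mxE s0 ?mulr0 // aN.
Qed.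

Lemma kernel_syzygy_mx (v : 'rV[R]_r) :
  v *m A = 0 <-> exists w, v = w *m B.
Proof.
split=> [vA | [w ->]].
  (* This bound exceeds every key, so the vanishing condition is vacuous. *)
  have [|c _ ->] := @kernel_spanned (\max_b key b).+1 v vA; last by exists c.
  by move=> b; rewrite ltnNge leq_bigmax.
rewrite -mulmxA; suff -> : B *m A = 0 by rewrite mulmx0.
apply/row_matrixP => i; rewrite row_mul row0.
by have [a [x [_ xS ->]]] := syzygy_indexP i; have [] := sP xS.
Qed.

Lemma homogeneous_syzygy_mx : homogeneous_mx 1 B.
Proof.
move=> i b; have [a [x [_ xS /rowP /(_ b)]]] := syzygy_indexP i.
by rewrite mxE => ->; have [_ _ _] := sP xS.
Qed.

Definition syzygy_key (i : 'I_#|syzygy_index|) :=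
  (key (enum_val i).1 * n + (enum_val i).2)%N.

Definition syzygy_vars (i : 'I_#|syzygy_index|) :=
  [set y in S (enum_val i).1 | y < (enum_val i).2]%N.

Lemma linear_quotients_syzygy_mx : linear_quotients B syzygy_key syzygy_vars.
Proof.
split=> [i j ij | i f].
  apply: enum_val_inj; move: ij; rewrite /syzygy_key.
  case: (enum_val i) (enum_val j) => [a x] [b y] /=.
  by move=> /lex_key_inj [/lqA.1 -> ->].
rewrite /syzygy_vars /syzygy_key; have [a [x [-> xS ->]]] := syzygy_indexP i.
have [sA sa s0 _] := sP xS; split=> /=.
  (* Entry a of the relation puts f x in the ideal of the y < x in [S a]: an earlier syzygy has such
     a y as entry there if it leads at a, and 0 otherwise. Then x cancels. *)
  move=> [c c0 fs]; apply: (@var_ideal_prime_to_var _ _ _ x).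
    by rewrite inE ltnn andbF.
  have /rowP /(_ a) := fs; rewrite !mxE sa => ->.
  apply: ideal_gen_sum => j _.
  have [b [y [jby yS /rowP /(_ a)]]] := syzygy_indexP j; rewrite mxE => ->.
  have [lt_ji | le_ij] := boolP (key b * n + y < key a * n + x)%N; last first.
    have -> : c 0 j = 0 by apply: c0; rewrite /= jby.
    by rewrite mul0r; apply: ideal_gen0.
  apply: ideal_genM; have [_ sb sb0 _] := sP yS.
  move: lt_ji; rewrite lex_key => /orP [ba | /andP [/eqP /lqA.1 ba yx]].
    have ab : a != b by apply: contraTneq ba => ->; rewrite ltnn.
    by rewrite (sb0 a (ltnW ba) ab); apply: ideal_gen0.
  by rewrite -ba sb; apply: var_ideal_X; rewrite inE ba -{1}ba yS.
move=> /var_ideal_coefs [c ->]; rewrite scaler_suml.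
apply: spanned_sum => y; rewrite inE => /andP [yS yx].
rewrite -scalerA; apply: spannedZ.
have [tA ta t0 _] := sP yS.
(* The S-pair y s(a, x) - x s(a, y) has entry 0 at a, so it reduces to syzygies leading at rows of
   smaller key. *)
rewrite -(subrK ('X_x *: s (a, y)) ('X_y *: s (a, x))).
apply: spannedD; last first.
  apply/spannedZ/syzygy_spanned => // j /= ->.
  by rewrite lex_key eqxx yx orbT.
apply: (@spanned_sub _ _ _ [pred j | key (enum_val j).1 < key a]%N).
  by move=> j /= ja; rewrite lex_key ja.
apply: kernel_spanned.
  by rewrite mulmxBl -!scalemxAl sA tA !scaler0 subrr.
move=> b ab; rewrite !mxE; have [-> | ba] := eqVneq b a.
  by rewrite sa ta mulrC subrr.
by rewrite s0 // t0 // !mulr0 subrr.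
Qed.

End Syzygies.

(** * Iterating syzygies to a linear resolution *)

Definition has_linear_quotients (r q : nat) (A : 'M[R]_(r, q)) :=
  exists key S, linear_quotients A key S.

Lemma linear_syzygies (e r q : nat) (A : 'M[R]_(r, q)) :
    has_linear_quotients A -> homogeneous_mx e A ->
  exists B : {r' & 'M[R]_(r', r)},
    [/\ has_linear_quotients (tagged B), homogeneous_mx 1 (tagged B)
      & forall v : 'rV_r, v *m A = 0 <-> exists w, v = w *m tagged B].
Proof.
move=> [key [S lqA]] homA.
have /fin_all_exists [s sP] (p : 'I_r * 'I_n) :
    exists v, p.2 \in S p.1 -> leading_syzygy A key p.1 p.2 v.
  (* Choice is made over all pairs; 0 is a default outside the index set of the syzygies. *)
  have [pS | _] := boolP (p.2 \in S p.1); last by exists 0.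
  by have [v vP] := leading_syzygy_exists lqA homA pS; exists v.
have {}sP a x : x \in S a -> leading_syzygy A key a x (s (a, x)).
  exact: (sP (a, x)).
exists (Tagged (fun r' => 'M[R]_(r', r)) (syzygy_mx S s)); split.
- exists (@syzygy_key _ key S), (@syzygy_vars _ S).
  exact: (linear_quotients_syzygy_mx lqA sP).
- exact: (homogeneous_syzygy_mx sP).
- exact: (kernel_syzygy_mx lqA sP).
Qed.

(** Sizes and degree are fields, so that passing to syzygies is a map of this type to itself and can
    be iterated. *)
Record lq_matrix := LqMatrix {
  lq_rows : nat;
  lq_cols : nat;
  lq_mx : 'M[R]_(lq_rows, lq_cols);
  lq_degree : nat;
  lq_mxP : has_linear_quotients lq_mx;
  lq_homogeneous : homogeneous_mx lq_degree lq_mx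
}.

(** A description operator is used because the resolution needs the matrices as data. *)
Definition syzygies (M : lq_matrix) :=
  constructive_indefinite_description _
    (linear_syzygies (lq_mxP M) (@lq_homogeneous M)).

(** The number of columns is [lq_rows M] by computation, so consecutive matrices compose without
    casts. *)
Definition next_lq (M : lq_matrix) : lq_matrix :=
  let BP := proj2_sig (syzygies M) in
  @LqMatrix _ (lq_rows M) (tagged (proj1_sig (syzygies M))) 1
    (let: And3 lqB _ _ := BP in lqB) (let: And3 _ homB _ := BP in homB).

Lemma linear_quotients_resolution (d r : nat) (A : 'cV[R]_r) (I : R -> Prop) :
    has_linear_quotients A -> homogeneous_mx d A ->
    (forall p, I p <-> exists v : 'rV_r, v *m A = p%:M) ->
  exists2 F, minimal_graded_free_resolution F I &
    forall i j, j <> (i + d)%N -> betti F i j = 0%N.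
Proof.
move=> lqA homA IA.
pose M i := iter i next_lq (LqMatrix lqA homA).
pose B i : 'M_(lq_rows (M i.+1), lq_rows (M i)) :=
  tagged (proj1_sig (syzygies (M i))).
have homB i : homogeneous_mx 1 (B i).
  exact: (@lq_homogeneous (M i.+1)).
have kerB i (v : 'rV_(lq_rows (M i))) :
    v *m lq_mx (M i) = 0 <-> exists w, v = w *m B i.
  by have [_ _ kerC] := proj2_sig (syzygies (M i)); apply: kerC.
(* A has degree d and every later matrix degree 1, so all generators of the i-th module sit in
   degree i + d. *)
exists (@FreeChain k n (fun i => lq_rows (M i)) (fun i _ => i + d)%N A B).
  split=> //=.
  - by move=> i j; rewrite subn0 homA.
  - by move=> i a b; rewrite addSn leqnSn subSnn homB.
  - exact: (kerB 0%N).
  - by move=> i; apply: (kerB i.+1).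
  (* Minimality: each monomial of a linear form is a variable. *)
  - move=> i a b; apply/var_idealP => m /(dhomogP _ _ _ (homB i a b)) /= m1.
    have /eqP/mdeg1P [j /eqP ->] := m1.
    by exists j; rewrite ?inE ?mnm1E ?eqxx.
move=> i j /eqP ij; rewrite /betti; apply/eqP; rewrite cards_eq0.
by apply/eqP/setP => a; rewrite !inE /= eq_sym (negbTE ij).
Qed.

End LinearQuotients.

(** * The exchange property for at most three sets *)

Section Exchange.

Variables (n : nat) (T : finType) (J : T -> {set 'I_n}) (a : T -> nat).
Variable pos : 'I_n -> nat.
Hypothesis pos_inj : injective pos.
Hypothesis card_T : #|T| <= 3.
Hypothesis pos_mono : forall x y, pos y <= pos x ->
  #|[set i | y \in J i]| <= #|[set i | x \in J i]|.
Implicit Types u v : 'X_{1..n}.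

Definition admissible u := [forall i, a i <= degree_in (J i) u].

(** The boolean factor [P x] lets one formula serve whether or not x is in P, hence for the total
    degree and for the degree in J_i alike. *)
Lemma sum_split_pos (P : pred 'I_n) (F : 'I_n -> nat) (x : 'I_n) :
  \sum_(y | P y) F y = \sum_(y | P y && (pos y < pos x)) F y
    + P x * F x + \sum_(y | P y && (pos x < pos y)) F y.
Proof.
rewrite (bigID (fun y => pos y < pos x)) -addnA; congr (_ + _).
rewrite (bigID (fun y => pos x < pos y)) addnC; congr (_ + _).
  by apply: eq_bigl => y /=; case: ltngtP; rewrite ?andbF ?andbT.
have [Px | Px] := boolP (P x).
  rewrite /= mul1n (big_pred1 x) // => y /=; rewrite -!leqNgt -andbA -eqn_leq.
  rewrite (inj_eq pos_inj) eq_sym; case: eqP => [-> | _]; last by rewrite andbF.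
  by rewrite Px.
rewrite /= mul0n big_pred0 // => y /=; rewrite -!leqNgt -andbA -eqn_leq.
by rewrite (inj_eq pos_inj); case: eqP => [<- | _]; rewrite ?andbF ?(negbTE Px).
Qed.

(* If no y works, each y of the support of v below x lies in some J_i that
   avoids x and on which v is tight.  It lies in only one such J_i: there are at
   most min (s, 3 - s) <= 1 of them, where s is the number of sets containing x.
   Summing the constraints of u over the tight J_i then shows that u has at least
   the degree of v below x, against mdeg u = mdeg v. *)
Lemma lex_exchange u v x :
    mdeg u = mdeg v -> admissible u -> admissible v -> v x < u x ->
    (forall y, pos x < pos y -> u y = v y) ->
  exists y, [/\ pos y < pos x, 0 < v y & admissible (v - U_(y) + U_(x))%MM].
Proof.
move=> duv /forallP au /forallP av vu_x above.
have [/existsP [y /and3P [? ? ?]] | noex] :=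
  boolP [exists y, [&& pos y < pos x, 0 < v y & admissible (v - U_(y) + U_(x))%MM]].
  by exists y.
pose tight y i := [&& x \notin J i, y \in J i & degree_in (J i) v == a i].
(* Replacing y by x lowers the degree in J_i only if J_i contains y but not x, and then by exactly
   one. *)
have tight_ex y : pos y < pos x -> 0 < v y -> exists i, tight y i.
  move=> yx vy; move: noex; rewrite negb_exists => /forallP /(_ y).
  rewrite yx vy /= negb_forall => /existsP [i].
  rewrite -ltnNge degree_inD degree_inU => lt_ai; exists i.
  have vE : degree_in (J i) v = (y \in J i) + degree_in (J i) (v - U_(y))%MM.
    by rewrite {1}(monomial_split vy) degree_inD degree_inU.
  have := av i; rewrite /tight vE => ge_ai.
  by case: (x \in J i) (y \in J i) lt_ai ge_ai => [] [] /=; lia.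
pose c y := #|[set i | tight y i]|.
have c_gt0 y : pos y < pos x -> 0 < v y -> 0 < c y.
  move=> yx /(tight_ex _ yx) [i ti].
  by rewrite card_gt0; apply/set0Pn; exists i; rewrite inE.
have c_le1 y : pos y < pos x -> c y <= 1.
  move=> yx; have := pos_mono (ltnW yx).
  have : c y <= #|[set i | y \in J i]|.
    by apply/subset_leq_card/subsetP => i; rewrite !inE => /and3P [].
  have : c y <= #|~: [set i | x \in J i]|.
    by apply/subset_leq_card/subsetP => i; rewrite !inE => /and3P [].
  by have := cardsC [set i | x \in J i]; lia.
have sum_below : \sum_(y | pos y < pos x) u y < \sum_(y | pos y < pos x) v y.
  move: duv; rewrite !mdegE (sum_split_pos _ _ x) [RHS](sum_split_pos _ _ x) /=.
  by rewrite (eq_bigr (fun y => v y) above); lia.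
have sum_tight i : x \notin J i -> degree_in (J i) v == a i ->
    \sum_(y in J i | pos y < pos x) v y <= \sum_(y in J i | pos y < pos x) u y.
  move=> /negbTE xJ /eqP vi; have := au i; rewrite -vi /degree_in.
  rewrite (sum_split_pos _ _ x) [X in _ <= X](sum_split_pos _ _ x) xJ.
  have -> : \sum_(y in J i | pos x < pos y) u y = \sum_(y in J i | pos x < pos y) v y.
    by apply: eq_bigr => y /andP [_ /above].
  by rewrite /= !mul0n !addn0 leq_add2r.
(* Double counting of the pairs of a variable y below x and an index tight at y, weighted by F. *)
have sum_c (F : 'I_n -> nat) : \sum_(y | pos y < pos x) c y * F y =
    \sum_(i | (x \notin J i) && (degree_in (J i) v == a i))
      \sum_(y in J i | pos y < pos x) F y.
  rewrite (exchange_big_dep (fun y => pos y < pos x)) /=; last by move=> i y _ /andP [].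
  apply: eq_bigr => y yx; rewrite sum_nat_const; congr (_ * _).
  rewrite /c cardsE; apply: eq_card => i; rewrite [LHS]unfold_in [RHS]unfold_in.
  by rewrite /tight yx andbT [(y \in _) && _]andbC andbA.
suff : \sum_(y | pos y < pos x) v y <= \sum_(y | pos y < pos x) u y by lia.
(* The weight c y is at least 1 where v y > 0, so it may be inserted for v; it is at most 1, so it
   may be dropped for u. *)
apply: (@leq_trans (\sum_(y | pos y < pos x) c y * v y)).
  by apply: leq_sum => y yx; case: (posnP (v y)) => [-> // | /(c_gt0 _ yx)]; nia.
apply: (@leq_trans (\sum_(y | pos y < pos x) c y * u y)).
  by rewrite !sum_c; apply: leq_sum => i /andP [xJ vi]; apply: sum_tight.
by apply: leq_sum => y /c_le1; nia.
Qed.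

(** * The lexicographic order on monomials, larger monomials first *)

Definition lex_before u v :=
  [exists x, (v x < u x) && [forall y, (pos x < pos y) ==> (u y == v y)]].

Lemma lex_beforeP u v :
  reflect (exists2 x, v x < u x & forall y, pos x < pos y -> u y = v y)
    (lex_before u v).
Proof.
apply: (iffP existsP) => [[x /andP [vux /forallP above]] | [x vux above]].
  by exists x => // y xy; apply/eqP; have := above y; rewrite xy.
by exists x; rewrite vux; apply/forallP => y; apply/implyP => /above ->.
Qed.

Lemma lex_before_irr u : ~~ lex_before u u.
Proof. by apply/lex_beforeP => -[x]; rewrite ltnn. Qed.

Lemma lex_before_trans u v w : lex_before u v -> lex_before v w -> lex_before u w.
Proof.
move=> /lex_beforeP [x vux xabove] /lex_beforeP [y wvy yabove].
apply/lex_beforeP; case: (ltngtP (pos x) (pos y)) => [xy | yx | /pos_inj xy].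
- exists y; first by rewrite xabove.
  by move=> z yz; rewrite xabove ?yabove // (ltn_trans xy).
- exists x; first by rewrite -yabove.
  by move=> z xz; rewrite xabove ?yabove // (ltn_trans yx).
- exists x; first by rewrite -xy in wvy; apply: ltn_trans vux.
  by move=> z xz; rewrite xabove ?yabove // -xy.
Qed.

Lemma lex_before_total u v : u != v -> lex_before u v || lex_before v u.
Proof.
move=> uv; have [x0 x0uv] : exists x, u x != v x.
  apply/existsP; apply: contra_neqT uv; rewrite negb_exists => /forallP uv.
  by apply/mnmP => x; apply/eqP; have := uv x; rewrite negbK.
case: (arg_maxnP (P := fun x => u x != v x) pos x0uv) => x xuv xmax.
have above y : pos x < pos y -> u y = v y.
  move=> xy; apply/eqP; apply: contraTT xy => /xmax.
  by rewrite -leqNgt.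
apply/orP; case: (ltngtP (u x) (v x)) xuv => // [uvx | vux] _; [right | left].
  by apply/lex_beforeP; exists x => // y /above.
by apply/lex_beforeP; exists x.
Qed.

(** * Linear quotients for the component of degree d *)

Variables (k : fieldType) (d : nat).
Local Notation R := {mpoly k[n]}.

(** Bounded exponents form a finite type, so the generators can be enumerated as rows; the bound is
    strict, whence [d.+1]. *)
Definition admissible_of_degree :=
  [set u : 'X_{1..n < d.+1} | (mdeg u == d) && admissible u].

Local Notation index := 'I_#|admissible_of_degree|.

Definition admissible_mon (i : index) : 'X_{1..n} := val (enum_val i).
Local Notation E := admissible_mon.

Lemma admissible_monP i : mdeg (E i) = d /\ admissible (E i).
Proof. by have := enum_valP i; rewrite inE => /andP [/eqP]. Qed.

Lemma admissible_mon_inj : injective E.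
Proof. by move=> i j /val_inj /enum_val_inj. Qed.

Lemma admissible_mon_index u : mdeg u = d -> admissible u -> exists i, E i = u.
Proof.
move=> du au; have lt_u : mdeg u < d.+1 by rewrite du.
have uM : BMultinom lt_u \in admissible_of_degree by rewrite inE /= du eqxx.
by exists (enum_rank_in uM (BMultinom lt_u)); rewrite /E enum_rankK_in.
Qed.

(** Counting predecessors turns the total order into the numerical key that [linear_quotients]
    expects. *)
Definition lex_rank (i : index) := #|[set j | lex_before (E j) (E i)]|.

Lemma lex_before_rank i j : lex_before (E i) (E j) -> lex_rank i < lex_rank j.
Proof.
move=> ij; apply/proper_card/properP; split.
  by apply/subsetP => l; rewrite !inE => /lex_before_trans /(_ ij).
by exists i; rewrite !inE // lex_before_irr.
Qed.

Lemma lex_rankP i j : (lex_rank i < lex_rank j) = lex_before (E i) (E j).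
Proof.
apply/idP/idP => [rij | /lex_before_rank //].
have [ij | ] := eqVneq (E i) (E j).
  by rewrite (admissible_mon_inj ij) ltnn in rij.
move=> /lex_before_total /orP [// | /lex_before_rank].
by rewrite ltnNge (ltnW rij).
Qed.

Lemma lex_rank_inj : injective lex_rank.
Proof.
move=> i j rij; apply: admissible_mon_inj; apply/eqP.
apply/negPn/negP => /lex_before_total.
by rewrite -!lex_rankP rij ltnn.
Qed.

(** For v = [E i], the monomial w = x v / y is then an earlier generator, and the colon ideal (w) :
    v is (x). *)
Definition exchange_vars (i : index) :=
  [set x | [exists y, [&& pos y < pos x, 0 < E i y
                        & admissible (E i - U_(y) + U_(x))%MM]]].

Definition admissible_col : 'cV[R]_#|admissible_of_degree| :=
  (\col_i 'X_[E i])%R.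

Lemma admissible_col_linear_quotients : has_linear_quotients admissible_col.
Proof.
exists lex_rank, exchange_vars; split=> [|i f]; first exact: lex_rank_inj.
have rowE i' : row i' admissible_col = ('X_[E i'])%:M%R.
  by apply/rowP => z; rewrite !mxE ord1 eqxx.
have [di ai] := admissible_monP i; split.
  move=> [c c0 /rowP /(_ ord0)]; rewrite !mxE => fX.
  (* Q describes the monomial ideal of the earlier generators, which contains f times generator
     i. *)
  pose Q := [pred m | [exists j, (lex_rank j < lex_rank i) && (E j <= m)%MM]].
  have upQ : upward_closed Q.
    move=> m m' /existsP [j /andP [ji jm]]; apply/existsP; exists j.
    by rewrite ji (lepm_trans jm) // lem_addr.
  have Qf : monomials_in Q (f * 'X_[E i])%R.
    rewrite fX; apply: big_ind => [||j _].
    - exact: monomials_in0.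
    - exact: monomials_inD.
    rewrite mxE; have [ji | ij] := boolP (lex_rank j < lex_rank i).
      apply: monomials_inM => // m /mem_msuppXP <-; apply/existsP; exists j.
      by rewrite ji lepm_refl.
    by rewrite c0 // GRing.mul0r; apply: monomials_in0.
  apply/var_idealP => m mf.
  have /existsP [j /andP [ji jm]] : Q (E i + m)%MM.
    by apply: Qf; rewrite mcoeff_msupp mcoeffMX -mcoeff_msupp.
  move: ji; rewrite lex_rankP => /lex_beforeP [x ltx above].
  (* At x, the first variable where they differ, [E j] exceeds [E i]; as [E j] divides [E i + m], x
     occurs in m. *)
  have [dj aj] := admissible_monP j; exists x.
    rewrite inE; apply/existsP.
    have [|y [yx iy ay]] := lex_exchange _ aj ai ltx above; first by rewrite dj di.
    by exists y; apply/and3P.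
  by have /mnm_lepP /(_ x) := jm; rewrite mnmDE; lia.
move=> /var_ideal_coefs [c ->]; rewrite GRing.scaler_suml.
apply: spanned_sum => x; rewrite inE => /existsP [y /and3P [yx iy aw]].
rewrite -GRing.scalerA; apply: spannedZ.
have [|j jw] := admissible_mon_index _ aw.
  rewrite mdegD mdeg1 addnC -di [in RHS](monomial_split iy) mdegD mdeg1.
  by [].
(* Here [E j] is x v / y for v = [E i], so both sides are x v; it is earlier because y lies below
   x. *)
have -> : ('X_x *: row i admissible_col = 'X_y *: row j admissible_col)%R.
  rewrite !rowE jw -!mul_scalar_mx -!scalar_mxM -!mpolyXD.
  by congr ('X_[_]%:M)%R; rewrite {1}(monomial_split iy); apply/mnmP => z; rewrite !mnmDE; lia.
apply/spannedZ/spanned_row => /=; rewrite lex_rankP jw; apply/lex_beforeP.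
have xy : (y == x) = false by case: eqP yx => // ->; rewrite ltnn.
exists x; first by rewrite mnmDE mnmBE !mnm1E eqxx xy; lia.
move=> z xz; rewrite mnmDE mnmBE !mnm1E.
have -> : (y == z) = false by case: eqP xz => // <-; lia.
have -> : (x == z) = false by case: eqP xz => // <-; rewrite ltnn.
lia.
Qed.

Lemma admissible_col_homogeneous : homogeneous_mx d admissible_col.
Proof. by move=> i j; rewrite mxE dhomogX /=; have [-> _] := admissible_monP i. Qed.

Variable I : R -> Prop.
Hypothesis IP : forall p, I p <-> monomials_in admissible p.

Lemma component_admissible_col p : component I d p <->
  exists v : 'rV_#|admissible_of_degree|, (v *m admissible_col = p%:M)%R.
Proof.
split=> [|[v /rowP /(_ ord0)]].
  pose K q := exists v : 'rV_#|admissible_of_degree|, (v *m admissible_col = q%:M)%R.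
  have K0 : K 0%R by exists 0%R; rewrite mul0mx raddf0.
  have KD q r : K q -> K r -> K (q + r)%R.
    by move=> [v vq] [w wr]; exists (v + w)%R; rewrite mulmxDl vq wr raddfD.
  have KM c q : K q -> K (c * q)%R.
    by move=> [v vq]; exists (c *: v)%R; rewrite -scalemxAl vq scale_scalar_mx.
  (* Every monomial of a form of degree d in I is itself admissible of degree d, hence an entry of
     the column. *)
  apply: (@ideal_gen_ind _ _ K) => // c g [/IP ag homg]; apply/KM.
  rewrite [g]mpolyE big_seq; apply: big_ind => // m mg.
  rewrite -mul_mpolyC; apply: KM.
  have [||i <-] := @admissible_mon_index m; [exact: dhomogP homg m mg | exact: ag |].
  exists (delta_mx ord0 i); rewrite -rowE.
  by apply/rowP => z; rewrite !mxE ord1 eqxx.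
rewrite !mxE eqxx GRing.mulr1n => <-; apply: ideal_gen_sum => i _.
rewrite mxE; apply/ideal_genM/ideal_gen_id.
have [di ai] := admissible_monP i; split; last by rewrite dhomogX /= di.
by apply/IP => m /mem_msuppXP <-.
Qed.

Lemma linear_resolution_component : linear_resolution d (component I d).
Proof.
split.
- move=> p; split; apply: ideal_gen_sub => q; last by case.
  by move=> Iq; apply: ideal_gen_id; split; [apply: ideal_gen_id | exists d; case: Iq].
- move=> p; split; apply: ideal_gen_sub => q; last by case.
  by move=> Iq; apply: ideal_gen_id; split; [apply: ideal_gen_id | case: Iq].
- apply: linear_quotients_resolution component_admissible_col.
    exact: admissible_col_linear_quotients.
  exact: admissible_col_homogeneous.
Qed.

Lemma admissible_homogeneous_ideal : homogeneous_ideal I.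
Proof.
move=> p; split.
  move=> /IP; apply: ideal_gen_monomials_in => m am; apply: ideal_gen_id.
  split; first by apply/IP => m' /mem_msuppXP <-.
  by exists (mdeg m); rewrite dhomogX.
move=> Ip; apply/IP; apply: monomials_in_ideal_gen Ip.
  move=> m m' /forallP am; apply/forallP => i.
  by apply: leq_trans (am i) _; rewrite degree_inD leq_addr.
by move=> q [/IP].
Qed.

End Exchange.

(** * Intersections of at most three powers *)

Lemma at_most_three_componentwise_linear (k : fieldType) (n : nat) (T : finType)
    (J : T -> {set 'I_n}) (a : T -> nat) (I : {mpoly k[n]} -> Prop) :
    #|T| <= 3 ->
    (forall p, I p <-> forall i, ideal_pow (var_ideal k (J i)) (a i) p) ->
  componentwise_linear I.
Proof.
move=> card_T IP.
have {}IP p : I p <-> monomials_in (admissible J a) p.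
  split=> [/IP Ip m mp | ap]; last first.
    by apply/IP => i; apply/ideal_powP => m /ap /forallP /(_ i).
  by apply/forallP => i; have /ideal_powP := Ip i; apply.
(* Variables are ranked by the number of sets containing them; the index breaks ties, which makes
   the ranking injective. *)
pose pos (x : 'I_n) := #|[set i | x \in J i]| * n + x.
have pos_inj : injective pos by move=> x y /lex_key_inj [].
have pos_mono x y : pos y <= pos x ->
    #|[set i | y \in J i]| <= #|[set i | x \in J i]|.
  by rewrite leqNgt lex_key negb_or -leqNgt => /andP [].
split; first exact: admissible_homogeneous_ideal IP.
by move=> d; apply: (linear_resolution_component pos_inj card_T pos_mono).
Qed.

Theorem theorem4p3 (k : fieldType) (n : nat) (J1 J2 J3 : {set 'I_n})
    (a1 a2 a3 : nat)
    (hJ1 : J1 != set0) (hJ2 : J2 != set0) (hJ3 : J3 != set0)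
    (ha1 : 0 < a1) (ha2 : 0 < a2) (ha3 : 0 < a3) :
  componentwise_linear
    (fun p : {mpoly k[n]} =>
       [/\ ideal_pow (var_ideal k J1) a1 p,
           ideal_pow (var_ideal k J2) a2 p &
           ideal_pow (var_ideal k J3) a3 p]).
Proof.
apply: (@at_most_three_componentwise_linear _ _ 'I_3
  (tnth [tuple J1; J2; J3]) (tnth [tuple a1; a2; a3])).
  by rewrite card_ord.
move=> p; split=> [[I1 I2 I3] [[|[|[|//]]] lt_i] | Ip] //.
by split; [exact: (Ip (@Ordinal 3 0 isT)) | exact: (Ip (@Ordinal 3 1 isT))
  | exact: (Ip (@Ordinal 3 2 isT))].
Qed.
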